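(* Let $S$ be a symmetric non-empty finite set of real numbers with total gap $1$ and let $M = \max_{s \in S} |s|$. Then $\Sigma^1_S$ contains the annulus $\frac{1}{\sqrt{M}} \leqslant |z| < 1$. In particular, we have that $\rho_{inn}(S) \leqslant \frac{1}{\sqrt{M}}$.
   Context: $\mathbb{D}$ is the open unit disc in $\mathbb{C}$. For a non-empty bounded set $S$ of complex numbers, $\Sigma_S = \{ z \in \mathbb{D} \mid \exists\, p_0, p_1, \ldots \in S,\ p_0 \neq 0,\ \sum_{j=0}^\infty p_j z^j = 0 \}$ and $\Sigma_S^1 = \{ z \in \mathbb{D} \mid \exists\, p_0, p_1, \ldots \in S,\ p_0 = 1,\ \sum_{j=0}^\infty p_j z^j = 0 \}$. A set $S$ is symmetric if $S = -S$. For a non-empty finite set of real numbers $S = \{s_1, s_2, \ldots, s_n\}$ with $s_j < s_{j+1}$, and with $m = \min\{|s| \mid s \in S, s \neq 0\}$, the total gap of $S$ is $\max_j \frac{|s_j - s_{j+1}|}{m}$. A finite non-empty set $S$ of real numbers is normalized if $1 \in S$ and $|s| \geqslant 1$ for every $s \in S$ with $s \neq 0$. The quantity $\rho_{inn}$ is defined as follows: if $S$ is a non-empty normalized finite set of real numbers, $\rho_{inn}(S) = \inf \{R > 0 \mid A_R \subseteq \Sigma_S \}$, where $A_R$ is the annulus $\{ R \leqslant |z| < 1\}$.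
   Formalization: The inclusion of the annulus in Σ¹_S is stated under the added hypothesis 1 ∈ S (it fails for S = {-2,0,2}, where Σ¹_S is empty), and the bound on ρ_inn(S) is stated for normalized S, the only case where ρ_inn is defined. *)

(* Defs.v *)
From HB Require Import structures.
From mathcomp Require Import all_boot all_order all_algebra finmap.
From mathcomp Require Import complex.
From mathcomp Require Import all_classical all_reals all_analysis.

Set Implicit Arguments.
Unset Strict Implicit.
Unset Printing Implicit Defensive.

Import Order.TTheory GRing.Theory Num.Theory.
Import numFieldNormedType.Exports.

Local Open Scope classical_set_scope.
Local Open Scope ring_scope.
Local Open Scope complex_scope.

(* [R[i]^o] carries the topology of the modulus; convergence of the partial
   sums to 0 says that the series converges and has sum 0. *)
Definition power_series_zero (R : realType) (p : nat -> R[i]) (z : R[i]) : Prop :=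
  series (fun j => p j * z ^+ j : R[i]^o) @ \oo --> (0 : R[i]^o).

Definition Sigma (R : realType) (S : set R[i]) : set R[i] :=
  [set z | `|z| < 1 /\
    exists p : nat -> R[i],
      [/\ forall j, S (p j), p 0%N != 0 & power_series_zero p z]].

Definition Sigma1 (R : realType) (S : set R[i]) : set R[i] :=
  [set z | `|z| < 1 /\
    exists p : nat -> R[i],
      [/\ forall j, S (p j), p 0%N = 1 & power_series_zero p z]].

(* The modulus on [R[i]] is valued in [R[i]], hence the cast of [r]. *)
Definition annulus (R : realType) (r : R) : set R[i] :=
  [set z | r%:C <= `|z| < 1].

Definition complex_set (R : realType) (S : {fset R}) : set R[i] :=
  [set x%:C | x in [set` S]].

Definition symmetric_set (R : realType) (S : {fset R}) : Prop :=
  S = [fset - x | x in S]%fset.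

Definition normalized (R : realType) (S : {fset R}) : Prop :=
  1 \in S /\ forall s, s \in S -> s != 0 -> 1 <= `|s|.

Definition max_abs (R : realType) (S : {fset R}) : R :=
  \big[Num.max/0]_(s <- S) `|s|.

(* The seed of the iterated minimum is a member of the list, so this is its
   minimum, unless S is contained in {0}, where the value is 0. *)
Definition min_nonzero_abs (R : realType) (S : {fset R}) : R :=
  let t := [seq `|s| | s <- S & s != 0] in \big[Num.min/head 0 t]_(x <- t) x.

(* The seed 0 matters only when S has at most one element. *)
Definition total_gap (R : realType) (S : {fset R}) : R :=
  let s := sort <=%R S in
  \big[Num.max/0]_(j < (size s).-1) (`|s`_j - s`_j.+1| / min_nonzero_abs S).

(* A genuine infimum: the set contains 1, as [annulus 1] is empty. *)
Definition rho_inn (R : realType) (S : {fset R}) : R :=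
  inf [set r : R | 0 < r /\ annulus r `<=` Sigma (complex_set S)].

(* Main.v *)
Require Import Defs.
From HB Require Import structures.
From mathcomp Require Import all_boot all_order all_algebra finmap.
From mathcomp Require Import complex.
From mathcomp Require Import all_classical all_reals all_analysis.
From mathcomp Require Import ring lra.

Set Implicit Arguments.
Unset Strict Implicit.
Unset Printing Implicit Defensive.

Import Order.TTheory GRing.Theory Num.Theory.
Import numFieldNormedType.Exports.

Local Open Scope classical_set_scope.
Local Open Scope ring_scope.

(** Put [c = 1/|z|^2] and [T = 2 Re z/|z|^2]; then [z] is a root of the real
    quadratic [1 - T w + c w^2].  If [q] is a bounded real sequence, the power
    series [(1 - T w + c w^2) * (q_1 + q_2 w + q_3 w^2 + ...)] vanishes at [z],
    so it is enough to find such a [q], with [q_1 = 1], for which the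
    coefficients of the product lie in [S].  The constant one is [q_1 = 1], and
    the others are [q_{n+2} - T q_{n+1} + c q_n], where [q_0 = 0].

    Changing [z] into [-z] only changes the signs of the coefficients of odd
    index, so by symmetry of [S] one may assume [T >= 0]
    ([Sigma1_complex_setN]).  The sequence [q] can then be kept in [[0, 1]]:
    if [q_n] and [q_{n+1}] are there, then [a = c q_n - T q_{n+1}] satisfies
    [- T <= a <= c].  Now [c <= M] says that [z] lies in the annulus, and
    [T <= 1 + c] says that [|1 - z|^2 >= 0], so [- M - 1 <= a <= M].  Since
    [M] and [- M] are in [S] and consecutive elements of [S] are at distance at
    most [1], some [p] in [S] lies in [[a, a + 1]] ([round_up]), and
    [q_{n+2} = p - a] is again in [[0, 1]] ([bounded_cofactor]).  Rounding
    always upwards, instead of to the nearest element, is what makes [q_1 = 1]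
    an admissible start and lets the two terms of [a] compensate each other. *)

(** * Rounding up in a symmetric finite set *)

(** A discrete intermediate value property: the entry that first reaches [a]
    exceeds it by at most one step. *)
Lemma bounded_steps_hit (R : realDomainType) (g a x : R) (s : seq R) :
    path (fun u v => v - u <= g) x s -> x <= a + g ->
    (exists2 y, y \in x :: s & a <= y) ->
  exists2 p, p \in x :: s & a <= p <= a + g.
Proof.
elim: s x => [|x' s IH] x /= => [_|/andP[step pth]] xa [y ys ay].
  move: ys; rewrite inE => /eqP yx; rewrite yx in ay.
  by exists x; rewrite ?mem_head // ay xa.
have [ax|xlta] := leP a x; first by exists x; rewrite ?mem_head // ax xa.
have [||p ps pa] := IH x' pth; first lra.
  exists y => //; move: ys; rewrite inE => /predU1P[yx|//].
  by move: ay; rewrite yx leNgt xlta.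
by exists p => //; rewrite inE ps orbT.
Qed.

Section SymmetricSet.
Variables (R : realType) (S : {fset R}).
Hypotheses (symS : symmetric_set S) (gapS : total_gap S = 1) (S1 : 1 \in S).

Lemma symmetric_setN x : x \in S -> - x \in S.
Proof. by move=> xS; rewrite symS; apply/imfsetP; exists x. Qed.

Lemma min_nonzero_abs_le1 : min_nonzero_abs S <= 1.
Proof.
rewrite /min_nonzero_abs /=; set t := map _ _.
have t1 : 1 \in t.
  by apply/mapP; exists 1; rewrite ?normr1 // mem_filter oner_eq0.
exact: (ge_bigmin_seq _ _ xpredT).
Qed.

Lemma le_max_abs x : x \in S -> `|x| <= max_abs S.
Proof. by move=> xS; apply: (le_bigmax_seq _ _ xpredT). Qed.

Lemma max_abs_ge1 : 1 <= max_abs S.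
Proof. by rewrite -[leLHS]normr1 le_max_abs. Qed.

Lemma max_abs_mem : max_abs S \in S.
Proof.
have [x xS ->] : exists2 x, x \in S & max_abs S = `|x|.
  have : max_abs S != 0 by rewrite gt_eqF // (lt_le_trans ltr01 max_abs_ge1).
  rewrite /max_abs big_seq; elim/big_ind: _ => [|x y IHx IHy|x xS _].
  - by rewrite eqxx.
  - by rewrite /Num.max; case: ifP.
  - by exists x.
by case: (ger0P x) => // _; apply: symmetric_setN.
Qed.

(** The total gap controls the steps only up to the factor [m], which is
    positive, as otherwise the total gap would be [0], and at most [1]. *)
Lemma sorted_steps : sorted (fun u v => v - u <= 1) (sort <=%R S).
Proof.
set m := min_nonzero_abs S.
have m_gt0 : 0 < m.
  rewrite ltNge; apply/negP => m_le0.
  suff : total_gap S <= 0 by rewrite gapS ler10.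
  apply/bigmax_leP; split=> // i _.
  by rewrite mulr_ge0_le0 // invr_le0.
apply/(sortedP 0) => i isz.
have isz' : (i < (size (sort <=%R S)).-1)%N by rewrite -ltnS; case: size isz.
have : `|(sort <=%R S)`_i - (sort <=%R S)`_i.+1| / m <= 1.
  rewrite -gapS; exact: (le_bigmax _ _ (Ordinal isz')).
rewrite ler_pdivrMr // mul1r distrC => le_m.
by apply: le_trans (ler_norm _) (le_trans le_m min_nonzero_abs_le1).
Qed.

Lemma round_up a :
  - max_abs S - 1 <= a <= max_abs S -> exists2 p, p \in S & a <= p <= a + 1.
Proof.
move=> /andP[aM Ma].
have : sorted <=%R (sort <=%R S) by exact: (sort_sorted le_total).
have := sorted_steps; have := mem_sort <=%R S.
case: (sort _ _) => [|x s] /= memS; first by have := memS 1; rewrite S1.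
move=> steps /(order_path_min le_trans) /allP x_min.
have xM : x <= - max_abs S.
  have : - max_abs S \in x :: s by rewrite memS symmetric_setN ?max_abs_mem.
  by rewrite inE => /predU1P[<-//|/x_min].
have [||p ps pa] := bounded_steps_hit (a := a) steps.
- lra.
- by exists (max_abs S) => //; rewrite memS max_abs_mem.
- by exists p => //; rewrite -memS.
Qed.

(** * The bounded cofactor *)

(** [q] is shifted by one so that [q 0 = 0] stands for the missing coefficient
    of index [-1]; the quotient series is [q 1 + q 2 w + ...]. *)
Lemma bounded_cofactor (T c : R) :
    0 <= T -> T <= 1 + c -> 0 <= c -> c <= max_abs S ->
  exists q : nat -> R,
    [/\ q 0%N = 0, q 1%N = 1, forall n, 0 <= q n <= 1 &
        forall n, q n.+2 - T * q n.+1 + c * q n \in S].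
Proof.
move=> T0 Tc c0 cM.
have /choice[f fP] : forall a, exists p : R,
    - max_abs S - 1 <= a <= max_abs S -> p \in S /\ a <= p <= a + 1.
  move=> a; have [/round_up[p pS pa]|] := boolP (- max_abs S - 1 <= a <= max_abs S).
    by exists p.
  by exists 0.
(* The states of the recursion are the pairs [(q n, q n.+1)]. *)
pose a (s : R * R) := c * s.1 - T * s.2.
pose next s := (s.2, f (a s) - a s).
pose st n := iter n next (0, 1).
have in_range s : 0 <= s.1 <= 1 -> 0 <= s.2 <= 1 ->
    - max_abs S - 1 <= a s <= max_abs S.
  move: s => [u v] /= /andP[u0 u1] /andP[v0 v1].
  have cu0 : 0 <= c * u by rewrite mulr_ge0.
  have Tv0 : 0 <= T * v by rewrite mulr_ge0.
  have cu : c * u <= c by rewrite ler_piMr.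
  have Tv : T * v <= T by rewrite ler_piMr.
  by rewrite /a /=; apply/andP; split; lra.
have stP n : 0 <= (st n).1 <= 1 /\ 0 <= (st n).2 <= 1.
  elim: n => [|n [u01 v01]]; first by rewrite /st /= lexx ler01 lexx.
  rewrite /st iterS -/(st n) /=; split=> //.
  have [_ /andP[? ?]] := fP _ (in_range _ u01 v01).
  by apply/andP; split; lra.
exists (fun n => (st n).1); split=> // n; first by case: (stP n).
have [u01 v01] := stP n; have [+ _] := fP _ (in_range _ u01 v01).
rewrite /st !iterS -/(st n) /= /a.
by congr (_ \in S); ring.
Qed.

End SymmetricSet.

(** * Vanishing at [z] *)

(** Modulo [1 - T z + c z^2 = 0] the sum telescopes: two boundary terms of the
    product are left over. *)
Lemma partial_sum_multiple_quadratic (K : comPzRingType) (T c z : K)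
    (p q : nat -> K) :
    1 - T * z + c * z ^+ 2 = 0 -> q 0%N = 0 -> p 0%N = q 1%N ->
    (forall n, p n.+1 = q n.+2 - T * q n.+1 + c * q n) ->
  forall n, \sum_(0 <= j < n.+1) p j * z ^+ j
    = q n.+1 * z ^+ n - c * q n * z ^+ n.+1.
Proof.
move=> z_root q0 p0 pS; elim=> [|n IH].
  by rewrite big_nat1 q0 p0 mulr0 mul0r subr0.
rewrite big_nat_recr //= IH pS.
apply/eqP; rewrite -subr_eq0; apply/eqP.
rewrite -[RHS](mulr0 (q n.+1 * z ^+ n)) -z_root !exprS; ring.
Qed.

Lemma cvg0_le_geometric (R : realType) (u : nat -> R[i]) (A x : R) :
    `|x| < 1 -> (forall n, `|u n| <= (A * x ^+ n)%:C%C) ->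
  (u : nat -> R[i]^o) @ \oo --> (0 : R[i]^o).
Proof.
move=> x1 uA.
have Ax0 : (fun n => A * x ^+ n) @ \oo --> (0 : R).
  by rewrite -(mulr0 A); apply: cvgMr => //; exact: cvg_expr.
apply/cvgr0Pnorm_lt => e e0.
(* The modulus takes values in [R[i]], so the radii do too; positive ones are
   real. *)
have eE : e = (complex.Re e)%:C%C by rewrite RRe_real ?gtr0_real.
have Re0 : 0 < complex.Re e by move: e0; rewrite eE ltcR.
near=> n; apply: le_lt_trans (uA n) _.
rewrite eE ltcR; apply: le_lt_trans (ler_norm _) _.
by near: n; move/cvgr0Pnorm_lt: Ax0; apply.
Unshelve. all: by end_near. Qed.

(** A real quadratic with constant term [1] and root [z] also has the root
    [conj z], which forces its coefficients: [1/z + 1/conj z = 2 Re z / d] and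
    [1/(z conj z) = 1/d]. *)
Lemma root_real_quadratic (R : rcfType) (z : R[i]) :
  let d := complex.Re z ^+ 2 + complex.Im z ^+ 2 in d != 0 ->
  1 - (2 * complex.Re z / d)%:C%C * z + (d^-1)%:C%C * z ^+ 2 = 0.
Proof.
case: z => a b /= d0; rewrite expr2; apply/eqP.
by rewrite eq_complex /= ; apply/andP; split; apply/eqP; field.
Qed.

(** The sign [(-1)^j] of [(- z)^j] is absorbed by the coefficient of index [j]. *)
Lemma Sigma1_complex_setN (R : realType) (S : {fset R}) (z : R[i]) :
  symmetric_set S -> Sigma1 (complex_set S) z -> Sigma1 (complex_set S) (- z).
Proof.
move=> symS [z1 [p [pS p0 pz]]]; split; first by rewrite normrN.
exists (fun j => (-1) ^+ j * p j); split=> [j||].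
- have [x xS <-] := pS j; rewrite -signr_odd; case: (odd j).
    exists (- x); first exact: symmetric_setN.
    by rewrite expr1 mulN1r rmorphN.
  by exists x; rewrite ?expr0 ?mul1r.
- by rewrite expr0 mul1r.
- rewrite /power_series_zero; under eq_fun => j.
    rewrite [(- z) ^+ j]exprNn mulrACA -expr2 sqrr_sign mul1r.
  over.
  exact: pz.
Qed.

(** [Re z >= 0] makes [T >= 0], as [bounded_cofactor] requires; [q] being
    bounded, the partial sums are then of the order of [|z|^n]. *)
Lemma Sigma1_Re_ge0 (R : realType) (S : {fset R}) (z : R[i]) :
    symmetric_set S -> total_gap S = 1 -> 1 \in S -> 0 <= complex.Re z ->
    annulus (1 / Num.sqrt (max_abs S)) z ->
  Sigma1 (complex_set S) z.
Proof.
move=> symS gapS S1 Rez0 /andP[rz z1].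
split=> //.
set d := complex.Re z ^+ 2 + complex.Im z ^+ 2.
have normzE : `|z| = (Num.sqrt d)%:C%C by rewrite normc_def.
have M1 := max_abs_ge1 S1.
have M0 : 0 < max_abs S by lra.
have sM0 : 0 < Num.sqrt (max_abs S) by rewrite sqrtr_gt0.
move: (rz); rewrite normzE lecR div1r => sd.
have d0 : 0 < d by rewrite -sqrtr_gt0 (lt_le_trans _ sd) // invr_gt0.
have dM : d^-1 <= max_abs S.
  by rewrite invf_ple ?posrE // -ler_sqrt ?(ltW d0) // sqrtrV ?(ltW M0).
have sd1 : Num.sqrt d < 1 by move: z1; rewrite normzE ltcR.
have T_le : 2 * complex.Re z / d <= 1 + d^-1.
  rewrite ler_pdivrMr // [leRHS]mulrDl mulVf ?gt_eqF // mul1r /d.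
  have := sqr_ge0 (complex.Re z - 1); have := sqr_ge0 (complex.Im z).
  by rewrite sqrrB1; lra.
have T0 : 0 <= 2 * complex.Re z / d by rewrite divr_ge0 ?mulr_ge0 // ltW.
have c0 : 0 <= d^-1 by rewrite invr_ge0 ltW.
have [q [q0 q1 q01 qS]] := bounded_cofactor symS gapS S1 T0 T_le c0 dM.
have := root_real_quadratic (z := z); rewrite -/d /= => /(_ (lt0r_neq0 d0)).
set T : R := 2 * _ / d => z_root.
pose p n := if n is n'.+1 then q n'.+2 - T * q n'.+1 + d^-1 * q n' else q 1%N.
exists (fun n => (p n)%:C%C); split=> [[|n]||]; [| |by rewrite /= q1|].
- by exists 1; rewrite //= q1.
- by exists (p n.+1); first exact: qS.
rewrite /power_series_zero -cvg_shiftS.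
apply: (@cvg0_le_geometric _ _ (1 + d^-1) (Num.sqrt d)).
  by rewrite ger0_norm ?sqrtr_ge0.
move=> n; rewrite /series /=.
rewrite (partial_sum_multiple_quadratic (q := fun n => (q n)%:C%C) z_root) //=;
  first last.
- by move=> k; rewrite rmorphD rmorphB !rmorphM.
- by rewrite q0.
have qn k : `|(q k)%:C%C : R[i]| <= 1.
  by have /andP[? ?] := q01 k; rewrite ger0_norm ?lecR // -[1]/(1%:C%C) lecR.
apply: le_trans (ler_normB _ _) _.
rewrite !normrM !normrX normzE.
have cn : `|(d^-1)%:C%C : R[i]| = (d^-1)%:C%C by rewrite ger0_norm // lecR.
have xn k : 0 <= ((Num.sqrt d)%:C%C : R[i]) ^+ k.
  by rewrite exprn_ge0 // -[0]/(0%:C%C) lecR sqrtr_ge0.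
have c0' : (0 : R[i]) <= (d^-1)%:C%C by rewrite lecR.
rewrite cn rmorphM rmorphD rmorphXn /= mulrDl; apply: lerD.
  by rewrite rmorph1 ler_wpM2r.
rewrite -mulrA ler_wpM2l // exprS.
rewrite mulrA ler_piMl // mulr_ile1 //.
  by rewrite lecR sqrtr_ge0.
by rewrite -[1]/(1%:C%C) lecR ltW.
Qed.

Theorem theorem3p9 (R : realType) (S : {fset R}) :
  S != fset0 -> symmetric_set S -> total_gap S = 1 ->
  (1 \in S -> annulus (1 / Num.sqrt (max_abs S)) `<=` Sigma1 (complex_set S)) /\
  (normalized S -> rho_inn S <= 1 / Num.sqrt (max_abs S)).
Proof.
move=> _ symS gapS.
have annS : 1 \in S ->
    annulus (1 / Num.sqrt (max_abs S)) `<=` Sigma1 (complex_set S).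
  move=> S1 z zA; have [Rez|Rez] := leP 0 (complex.Re z).
    exact: Sigma1_Re_ge0.
  rewrite -[z]opprK; apply: Sigma1_complex_setN => //.
  apply: Sigma1_Re_ge0 => //; last by rewrite /annulus /= normrN.
  by case: z Rez {zA} => a b /=; lra.
split=> // -[S1 _]; apply: ge_inf; first by exists 0 => r [/ltW].
split.
  by rewrite div1r invr_gt0 sqrtr_gt0 (lt_le_trans ltr01 (max_abs_ge1 S1)).
move=> z /(annS S1)[z1 [p [pS p0 pz]]]; split=> //; exists p; split=> //.
by rewrite p0 oner_neq0.
Qed.
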